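(* Let $\mathcal{L}$ be a first-order language, let $\mathcal{M}$ be an $\mathcal{L}$-structure and let $\theta \in \operatorname{Con}(\mathcal{M})$. Let $[\theta, M^2] = \{\, \psi \in \operatorname{Con}(\mathcal{M}) \mid \theta \subseteq \psi \,\}$ be the principal filter of $\operatorname{Con}(\mathcal{M})$ generated by the congruence $\theta$. Then $[\theta, M^2]$ and $\operatorname{Con}(\mathcal{M}/\theta)$ are isomorphic lattices.
   Context: The universe of an $\mathcal{L}$-structure $\mathcal{M}$ is denoted $M$; constants are $0$-ary function symbols. A congruence on $\mathcal{M}$ is an equivalence relation $\theta$ on $M$ such that whenever $(x_i,y_i) \in \theta$ for $1 \le i \leq n$: $(F^{\mathcal{M}}(x_1,\dots,x_n), F^{\mathcal{M}}(y_1,\dots,y_n)) \in \theta$ for every $n$-ary function symbol $F$, and $R^{\mathcal{M}}(x_1,\dots,x_n) \iff R^{\mathcal{M}}(y_1,\dots,y_n)$ for every $n$-ary relation symbol $R$. $\operatorname{Con}(\mathcal{M})$ is the set of congruences on $\mathcal{M}$, a lattice under inclusion. For a congruence $\theta$ on $\mathcal{M}$, the quotient $\mathcal{M}/\theta$ is the $\mathcal{L}$-structure with universe $M/\theta = \{[x]_\theta \mid x \in M\}$, $F^{\mathcal{M}/\theta}([x_1]_\theta,\dots,[x_n]_\theta) = [F^{\mathcal{M}}(x_1,\dots,x_n)]_\theta$ and $R^{\mathcal{M}/\theta}([x_1]_\theta,\dots,[x_n]_\theta) \iff R^{\mathcal{M}}(x_1,\dots,x_n)$. The symbol $[\theta,M^2]$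 is only notation for the displayed set, ordered by inclusion; $M^2$ itself need not be a congruence. *)

(* Defs.v *)
From HB Require Import structures.
From Stdlib Require Export Relation_Operators.
From mathcomp Require Export all_boot all_order.
From mathcomp Require Export boolp classical_sets functions.

Set Implicit Arguments.
Unset Strict Implicit.
Unset Printing Implicit Defensive.

Import Order.TTheory.
Local Open Scope classical_set_scope.

(** Constants are 0-ary function symbols; universes may be empty. *)

Record language := Language {
  fun_symbol : Type;
  rel_symbol : Type;
  fun_arity : fun_symbol -> nat;
  rel_arity : rel_symbol -> nat }.

Record structure (L : language) := Structure {
  universe :> Type;
  fun_interp : forall F : fun_symbol L,
    ('I_(fun_arity F) -> universe) -> universe;
  rel_interp : forall R : rel_symbol L,
    ('I_(rel_arity R) -> universe) -> Prop }.

(** Relation symbols must be both preserved and reflected, hence the [<->]. *)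

Record congruence (L : language) (M : structure L) (theta : set (M * M)) :
    Prop := Congruence {
  cong_refl : forall x, theta (x, x);
  cong_sym : forall x y, theta (x, y) -> theta (y, x);
  cong_trans : forall x y z, theta (x, y) -> theta (y, z) -> theta (x, z);
  cong_fun : forall (F : fun_symbol L) (x y : 'I_(fun_arity F) -> M),
    (forall i, theta (x i, y i)) -> theta (fun_interp x, fun_interp y);
  cong_rel : forall (R : rel_symbol L) (x y : 'I_(rel_arity R) -> M),
    (forall i, theta (x i, y i)) -> rel_interp x <-> rel_interp y }.

Definition congruences (L : language) (M : structure L) : set (set (M * M)) :=
  [set theta | congruence theta].
Arguments congruences {L} M.

(** [Con M] is a named copy of the subtype of [set (M * M)] given by
    [congruences M]; it carries the inclusion order. *)

Definition Con (L : language) (M : structure L) : Type :=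
  {theta : set (M * M) | theta \in congruences M}.

HB.instance Definition _ (L : language) (M : structure L) :=
  SubChoice.on (Con M).
HB.instance Definition _ (L : language) (M : structure L) :=
  [SubChoice_isSubPOrder of Con M by <: with set_display].

Lemma ConP (L : language) (M : structure L) (theta : Con M) :
  congruence (val theta).
Proof. exact/set_mem/(valP theta). Qed.

Lemma leConE (L : language) (M : structure L) (phi psi : Con M) :
  (phi <= psi)%O = (val phi `<=` val psi) :> Prop.
Proof. by rewrite -subsetEset. Qed.

Definition cong_join (T : Type) (phi psi : set (T * T)) : set (T * T) :=
  [set p | clos_trans T (fun x y => (phi `|` psi) (x, y)) p.1 p.2].

Section Lattice.
Variables (L : language) (M : structure L).
Implicit Types phi psi chi : set (M * M).

Lemma congruence_setI phi psi :
  congruence phi -> congruence psi -> congruence (phi `&` psi).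
Proof.
move=> [r1 s1 t1 f1 p1] [r2 s2 t2 f2 p2]; split.
- by move=> x; split.
- by move=> x y [/s1 ? /s2 ?]; split.
- by move=> x y z [xy1 xy2] [yz1 yz2]; split; [exact: t1 yz1|exact: t2 yz2].
- by move=> F x y h; split; [apply: f1 => i|apply: f2 => i]; case: (h i).
- by move=> R x y h; apply: p1 => i; case: (h i).
Qed.

(* A preorder that follows single-coordinate [S]-steps also follows simultaneous
   [clos_trans S]-steps in all coordinates. *)
Lemma clos_trans_args (n : nat) (S : M -> M -> Prop) (A : Type)
    (G : ('I_n -> M) -> A) (E : A -> A -> Prop) :
    (forall a, E a a) -> (forall a b c, E a b -> E b c -> E a c) ->
    (forall x, S x x) ->
    (forall x y, (forall i, S (x i) (y i)) ->
       (exists k, forall i, i != k -> x i = y i) -> E (G x) (G y)) ->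
  forall x y, (forall i, clos_trans M S (x i) (y i)) -> E (G x) (G y).
Proof.
move=> Er Et Sr EG x y xy.
pose h k (i : 'I_n) := if (i < k)%N then y i else x i.
have Eh k : (k <= n)%N -> E (G x) (G (h k)).
  elim: k => [_|k IH kn].
    by have -> : h 0%N = x by exact/funext.
  apply: (Et _ _ _ (IH (ltnW kn))).
  pose u a (i : 'I_n) := if i == Ordinal kn then a else h k i.
  have -> : h k = u (x (Ordinal kn)).
    apply/funext => i; rewrite /u; case: eqP => // ->.
    by rewrite /h /= ltnn.
  have -> : h k.+1 = u (y (Ordinal kn)).
    apply/funext => i; rewrite /u; case: eqP => [->|/eqP ik].
      by rewrite /h /= ltnSn.
    by rewrite /h ltnS leq_eqVlt (_ : (i == k :> nat) = false)//; apply/negbTE.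
  elim: {xy}(xy (Ordinal kn)) => [a b ab|a b c _ ab _ bc]; last exact: Et ab bc.
  apply: EG => [i|]; first by rewrite /u; case: ifP.
  by exists (Ordinal kn) => i /negbTE ik; rewrite /u ik.
have -> : y = h n by apply/funext => i; rewrite /h ltn_ord.
exact: Eh.
Qed.

Lemma congruence_cong_join phi psi :
  congruence phi -> congruence psi -> congruence (cong_join phi psi).
Proof.
move=> [r1 s1 t1 f1 p1] [r2 s2 t2 f2 p2].
set U := fun x y => (phi `|` psi) (x, y).
have step n (x y : 'I_n -> M) : (forall i, U (x i) (y i)) ->
    (exists k, forall i, i != k -> x i = y i) ->
    (forall i, phi (x i, y i)) \/ (forall i, psi (x i, y i)).
  move=> xy [k eq_xy]; case: (xy k) => xyk; [left|right] => i;
    by case: (eqVneq i k) => [->//|/eq_xy ->].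
rewrite /cong_join; split => /=.
- by move=> x; apply: t_step; left.
- move=> x y; elim=> [a b [/s1|/s2] ab|a b c _ ab _ bc];
    last exact: t_trans bc ab.
  + by apply: t_step; left.
  + by apply: t_step; right.
- by move=> x y z; exact: t_trans.
- move=> F; apply: clos_trans_args.
  + by move=> a; apply: t_step; left.
  + by move=> a b c; exact: t_trans.
  + by move=> a; left.
  + move=> x y xy /(step _ _ _ xy)[/f1|/f2] Fxy; apply: t_step.
    * by left.
    * by right.
- move=> R; apply: clos_trans_args.
  + by move=> a.
  + by move=> a b c -> ->.
  + by move=> a; left.
  + by move=> x y xy /(step _ _ _ xy)[/p1|/p2].
Qed.

Lemma cong_join_subset phi psi chi : congruence chi ->
  (cong_join phi psi `<=` chi) <-> (phi `<=` chi) /\ (psi `<=` chi).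
Proof.
rewrite /cong_join => cchi; split => [jc|[pc qc] [x y] /=].
  by split=> -[x y] xy; apply: jc; apply: t_step; [left|right].
elim=> [a b [/pc|/qc]//|a b c _ ab _ bc].
exact: (cong_trans cchi ab bc).
Qed.

Definition con_meet (phi psi : Con M) : Con M :=
  exist _ (val phi `&` val psi)
    (mem_set (congruence_setI (ConP phi) (ConP psi))).

Definition con_join (phi psi : Con M) : Con M :=
  exist _ (cong_join (val phi) (val psi))
    (mem_set (congruence_cong_join (ConP phi) (ConP psi))).

Lemma con_meetP (chi phi psi : Con M) :
  (chi <= con_meet phi psi)%O = (chi <= phi)%O && (chi <= psi)%O.
Proof. by apply/idP/andP; rewrite !leConE /= subsetI. Qed.

Lemma con_joinP (phi psi chi : Con M) :
  (con_join phi psi <= chi)%O = (phi <= chi)%O && (psi <= chi)%O.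
Proof.
by apply/idP/andP; rewrite !leConE /= (cong_join_subset _ _ (ConP chi)).
Qed.

HB.instance Definition _ :=
  Order.POrder_MeetJoin_isLattice.Build set_display (Con M) con_meetP con_joinP.

End Lattice.

Definition above (d : Order.disp_t) (T : latticeType d) (a : T) : pred T :=
  fun x => (a <= x)%O.

Definition principal_filter (d : Order.disp_t) (T : latticeType d) (a : T) :
  Type := {x : T | above a x}.

Section PrincipalFilter.
Variables (d : Order.disp_t) (T : latticeType d) (a : T).

Fact above_meet : {in above a &, forall x y, (x `&` y)%O \in above a}.
Proof. by move=> x y; rewrite !unfold_in /above lexI => -> ->. Qed.

Fact above_join : {in above a &, forall x y, (x `|` y)%O \in above a}.
Proof. by move=> x y; rewrite !unfold_in /above => ax _; rewrite lexU2 ?ax. Qed.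

HB.instance Definition _ := SubChoice.on (principal_filter a).
HB.instance Definition _ := Order.SubChoice_isSubLattice.Build
  d T (above a) d (principal_filter a) above_meet above_join.

End PrincipalFilter.

(** The universe of [quotient theta] is literally the set of classes
    [[x]_theta]; operations and relations are computed on chosen
    representatives, see [quotient_fun] and [quotient_rel]. *)

Section Quotient.
Variables (L : language) (M : structure L) (theta : Con M).

Definition eq_class (x : M) : set M := [set y | val theta (x, y)].

Definition quotient_set : set (set M) := range eq_class.

Definition class_of (x : M) : quotient_set :=
  exist _ (eq_class x) (mem_set (imageT eq_class x)).

Lemma class_of_surj (c : quotient_set) : exists x, class_of x = c.
Proof. by have [x _ xc] := set_mem (valP c); exists x; apply/val_inj. Qed.

Definition class_repr (c : quotient_set) : M := projT1 (cid (class_of_surj c)).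

Definition quotient : structure L := {|
  universe := quotient_set;
  fun_interp F c := class_of (fun_interp (class_repr \o c));
  rel_interp R c := rel_interp (class_repr \o c) |}.

Lemma class_reprK (c : quotient_set) : class_of (class_repr c) = c.
Proof. exact: (projT2 (cid (class_of_surj c))). Qed.

Lemma class_of_eq (x y : M) : class_of x = class_of y <-> val theta (x, y).
Proof.
have ct := ConP theta; split=> [/(congr1 val) /= xy|xy].
  by rewrite -[val theta _]/(eq_class x y) xy; exact: (cong_refl ct).
apply/val_inj => /=; apply/seteqP; split=> z; rewrite /eq_class /=.
  exact: (cong_trans ct (cong_sym ct xy)).
exact: (cong_trans ct xy).
Qed.

Lemma quotient_fun (F : fun_symbol L) (x : 'I_(fun_arity F) -> M) :
  @fun_interp L quotient F (class_of \o x) = class_of (fun_interp x).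
Proof.
by apply/class_of_eq/(cong_fun (ConP theta)) => i; apply/class_of_eq/class_reprK.
Qed.

Lemma quotient_rel (R : rel_symbol L) (x : 'I_(rel_arity R) -> M) :
  @rel_interp L quotient R (class_of \o x) <-> rel_interp x.
Proof. by apply/(cong_rel (ConP theta)) => i; apply/class_of_eq/class_reprK. Qed.

End Quotient.

Definition isomorphic_lattices (d d' : Order.disp_t)
    (T : latticeType d) (T' : latticeType d') : Prop :=
  exists f : {lmorphism T -> T'}, bijective f.

(* Main.v *)
(** The isomorphism sends [psi] above [theta] to the set of pairs of classes
    with [psi]-related members, with inverse the pullback of congruences along
    [class_of]. Both maps are monotone, and an order isomorphism between lattices
    preserves meets and joins. *)

From HB Require Import structures.
Require Import Defs.

Set Implicit Arguments.
Unset Strict Implicit.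
Unset Printing Implicit Defensive.

Import Order.TTheory.
Local Open Scope order_scope.

Section OrderIsomorphism.
Variables (d d' : Order.disp_t) (T : latticeType d) (T' : latticeType d').
Variables (f : T -> T') (g : T' -> T).
Hypotheses (f_le : {homo f : x y / x <= y}) (g_le : {homo g : x y / x <= y}).
Hypotheses (fK : cancel f g) (gK : cancel g f).

Lemma order_iso_meet : {morph f : x y / x `&` y}.
Proof.
move=> x y; apply/le_anti/andP; split.
  by rewrite lexI !f_le ?leIl ?leIr.
(* The meet of the images is rewritten as [f] of its [g]-image; monotonicity of [f] then leaves only
   that this [g]-image lies below [x] and [y]. *)
rewrite -[leLHS]gK; apply: f_le; rewrite lexI.
by rewrite -{2}[x]fK -{3}[y]fK !g_le ?leIl ?leIr.
Qed.

Lemma order_iso_join : {morph f : x y / x `|` y}.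
Proof.
move=> x y; apply/le_anti/andP; split; last first.
  by rewrite leUx !f_le ?leUl ?leUr.
rewrite -[leRHS]gK; apply: f_le; rewrite leUx.
by rewrite -{1}[x]fK -{2}[y]fK !g_le ?leUl ?leUr.
Qed.

Lemma order_iso_isomorphic_lattices : isomorphic_lattices T T'.
Proof.
pose fo := Order.isOrderMorphism.Build d T d' T' f f_le.
pose fI := Order.isMeetLatticeMorphism.Build d T d' T' f order_iso_meet.
pose fU := Order.isJoinLatticeMorphism.Build d T d' T' f order_iso_join.
pose F : {lmorphism T -> T'} := HB.pack f fo fI fU.
by exists F; exists g.
Qed.

End OrderIsomorphism.

Section Correspondence.
Variables (L : language) (M : structure L) (theta : Con M).
Implicit Types (psi : set (M * M))
  (chi : set (quotient theta * quotient theta)).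

(** Testing [psi] on chosen representatives lets the equivalence axioms pass directly from [psi];
    for [psi] above [theta] the choice does not matter. *)
Definition pushforward psi : set (quotient theta * quotient theta) :=
  [set p | psi (class_repr p.1, class_repr p.2)]%classic.

Definition pullback chi : set (M * M) :=
  [set p | chi (class_of theta p.1, class_of theta p.2)]%classic.

(** An element is [theta]-related, hence [psi]-related, to the representative of its class, so
    transitivity exchanges one for the other. *)
Lemma pushforward_class_of psi : congruence psi -> (val theta `<=` psi)%classic ->
  forall x y, pushforward psi (class_of theta x, class_of theta y) <->
    psi (x, y).
Proof.
move=> cpsi le_theta x y.
have rK z : psi (class_repr (class_of theta z), z).
  exact/le_theta/class_of_eq/class_reprK.
split=> [xy|xy] /=.
  apply: (cong_trans cpsi (cong_sym cpsi (rK x))).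
  exact: (cong_trans cpsi xy (rK y)).
apply: (cong_trans cpsi (rK x)).
exact: (cong_trans cpsi xy (cong_sym cpsi (rK y))).
Qed.

Lemma congruence_pushforward psi : congruence psi ->
  (val theta `<=` psi)%classic -> congruence (pushforward psi).
Proof.
move=> cpsi le_theta; split.
- by move=> x; apply: (cong_refl cpsi).
- by move=> x y; apply: (cong_sym cpsi).
- by move=> x y z; apply: (cong_trans cpsi).
(* A quotient operation returns the class of a value computed in [M], and [pushforward] picks a new
   representative of that class; the previous lemma returns to the value itself. *)
- by move=> F x y xy; apply/pushforward_class_of => //; apply: (cong_fun cpsi).
- by move=> R x y xy; apply: (cong_rel cpsi).
Qed.

Lemma congruence_pullback chi : congruence chi -> congruence (pullback chi).
Proof.
move=> cchi; rewrite /pullback; split=> /=.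
- by move=> x; apply: (cong_refl cchi).
- by move=> x y; apply: (cong_sym cchi).
- by move=> x y z; apply: (cong_trans cchi).
(* Since [class_of] commutes with the operations, the classes of the two values are values of the
   quotient operation, where [chi] is compatible. *)
- by move=> F x y xy; rewrite -!quotient_fun; apply: (cong_fun cchi).
- move=> R x y xy; rewrite -(quotient_rel theta x) -(quotient_rel theta y).
  exact: (cong_rel cchi).
Qed.

(** Elements related by [theta] have equal classes, so reflexivity of [chi] suffices. *)
Lemma pullback_ge chi : congruence chi -> (val theta `<=` pullback chi)%classic.
Proof.
move=> cchi [x y] /class_of_eq xy; rewrite /pullback /= xy.
exact: (cong_refl cchi).
Qed.

Lemma principal_filter_le (psi : principal_filter theta) :
  (val theta `<=` val (val psi))%classic.
Proof. by rewrite -leConE; exact: (valP psi). Qed.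

Definition con_push (psi : principal_filter theta) : Con (quotient theta) :=
  exist _ (pushforward (val (val psi))) (mem_set
    (congruence_pushforward (ConP (val psi)) (@principal_filter_le psi))).

Definition con_pullback (chi : Con (quotient theta)) : Con M :=
  exist _ (pullback (val chi)) (mem_set (congruence_pullback (ConP chi))).

Lemma con_pullback_above (chi : Con (quotient theta)) :
  above theta (con_pullback chi).
Proof. by rewrite /above leConE; exact: (pullback_ge (ConP chi)). Qed.

Definition con_pull (chi : Con (quotient theta)) : principal_filter theta :=
  exist _ (con_pullback chi) (con_pullback_above chi).

Lemma con_push_le : {homo con_push : phi psi / phi <= psi}.
Proof.
move=> phi psi; rewrite -Order.le_val !leConE => le_phi p.
exact: le_phi.
Qed.

Lemma con_pull_le : {homo con_pull : phi psi / phi <= psi}.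
Proof.
move=> phi psi; rewrite -Order.le_val !leConE => le_phi p.
exact: le_phi.
Qed.

Lemma con_pushK : cancel con_push con_pull.
Proof.
(* The two injections strip the proofs of lying above [theta] and of being a congruence. *)
move=> psi; do 2 apply/val_inj; apply/seteqP.
by split=> -[x y] /(pushforward_class_of (ConP (val psi))
  (@principal_filter_le psi) x y).
Qed.

(** The round trip replaces each class by the class of its representative, which is the same
    class. *)
Lemma con_pullK : cancel con_pull con_push.
Proof.
move=> chi; apply/val_inj/seteqP.
by split=> -[c e]; rewrite /= /pushforward /pullback /= !class_reprK.
Qed.

End Correspondence.

Theorem theorem4p7 (L : language) (M : structure L) (theta : Con M) :
  isomorphic_lattices (principal_filter theta) (Con (quotient theta)).
Proof.
exact: order_iso_isomorphic_lattices (@con_push_le _ _ theta)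
  (@con_pull_le _ _ theta) (@con_pushK _ _ theta) (@con_pullK _ _ theta).
Qed.
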